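(* Let $\mathbb{F}=(W,\sqsubseteq,R,\mathsf{P})$ be a filter-descriptive possibility frame. Then every element of $\mathsf{PsAt}=\{\mathsf{ro}(\{w\})\mid w\in W\}$ is a closed element of $\mathsf{RO}(W)$, i.e.\ is the meet in $\mathsf{RO}(W)$ (equivalently, the intersection) of some subset of $\mathsf{P}$.
   Context: For a partial order $(W,\sqsubseteq)$, $\mathsf{int}(X)=\{x\mid\forall y\sqsubseteq x\,(y\in X)\}$, $\mathsf{cl}(X)=\{x\mid\exists y\sqsubseteq x\,(y\in X)\}$; $\mathsf{RO}(W)=\{X\subseteq W\mid \mathsf{int}(\mathsf{cl}(X))=X\}$ is a complete Boolean algebra whose meets are intersections (join $\mathsf{int}(\mathsf{cl}(X\cup Y))$, complement $\mathsf{int}(W\setminus X)$); $\mathsf{ro}(X)$ is the least regular open set containing $X$. For a binary relation $R$, $\Box_R(X)=\{w\mid\forall v(Rwv\Rightarrow v\in X)\}$. A possibility frame is $(W,\sqsubseteq,R,\mathsf{P})$ with $W\neq\emptyset$, $\sqsubseteq$ a partial order, $R$ a binary relation on $W$, and $\mathsf{P}\subseteq\mathsf{RO}(W)$ a Boolean subalgebra of $\mathsf{RO}(W)$ closed under $\Box_R$. It is filter-descriptive if (i) for all $w,v\in W$: if for all $X\in\mathsf{P}$ ($w\in\Box_RX\Rightarrow v\in X$) then $Rwv$; (ii) for all $w,v\in W$: if for all $X\in\mathsf{P}$ ($w\in X\Rightarrow v\in X$) then $v\sqsubseteq w$; (iii) every proper filter $F$ of the Boolean algebra $\mathsf{P}$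 equals $\{X\in\mathsf{P}\mid w\in X\}$ for some $w\in W$. An element of $\mathsf{RO}(W)$ is closed if it is a meet of elements of $\mathsf{P}$. *)

(* Defs.v *)
From Corelib Require Import Relation_Definitions.
From mathcomp Require Import all_boot.
From mathcomp Require Import boolp classical_sets.

Set Implicit Arguments.
Unset Strict Implicit.
Unset Printing Implicit Defensive.

Local Open Scope classical_set_scope.

Section RegularOpen.
Variables (W : Type) (le : relation W).

Definition down_int (X : set W) : set W := [set x | forall y, le y x -> X y].

Definition down_cl (X : set W) : set W := [set x | exists2 y, le y x & X y].

Definition RO : set (set W) := [set X | down_int (down_cl X) = X].

Definition RO_join (X Y : set W) : set W := down_int (down_cl (X `|` Y)).

Definition RO_compl (X : set W) : set W := down_int (~` X).

(* [A] is the greatest lower bound of [Q] in the poset (RO(W), inclusion). *)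
Definition RO_meet (Q : set (set W)) (A : set W) : Prop :=
  [/\ RO A,
      forall X, Q X -> A `<=` X
    & forall B, RO B -> (forall X, Q X -> B `<=` X) -> B `<=` A].

(* [smallest RO X] is the intersection of all regular opens containing [X];
   lemma [ro_least] shows that it is the least regular open containing [X]. *)
Definition ro (X : set W) : set W := smallest RO X.

Definition PsAt : set (set W) := [set ro [set w] | w in [set: W]].

Definition RO_subalgebra (P : set (set W)) : Prop :=
  [/\ P `<=` RO, P set0, P setT & [/\ forall X, P X -> P (RO_compl X),
      forall X Y, P X -> P Y -> P (X `&` Y)
    & forall X Y, P X -> P Y -> P (RO_join X Y)]].

End RegularOpen.

Definition box (W : Type) (R : relation W) (X : set W) : set W :=
  [set w | forall v, R w v -> X v].

Record possFrame := PossFrame {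
  pf_world :> Type;
  pf_le : relation pf_world;
  pf_rel : relation pf_world;
  pf_adm : set (set pf_world);
  pf_nonempty : [set: pf_world] !=set0;
  pf_order : Relation_Definitions.order pf_world pf_le;
  pf_subalg : RO_subalgebra pf_le pf_adm;
  pf_box : forall X, pf_adm X -> pf_adm (box pf_rel X)
}.

(* Proper filters of a Boolean subalgebra [P] of RO(W), whose order is
   inclusion and whose meet is intersection. *)
Definition proper_filter (W : Type) (P F : set (set W)) : Prop :=
  [/\ F `<=` P, F setT, forall X Y, F X -> F Y -> F (X `&` Y),
      forall X Y, F X -> P Y -> X `<=` Y -> F Y
    & F <> P].

Definition filter_descriptive (F : possFrame) : Prop :=
  [/\ forall w v : F,
        (forall X, pf_adm X -> box (@pf_rel F) X w -> X v) -> pf_rel w v,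
      forall w v : F, (forall X, pf_adm X -> X w -> X v) -> pf_le v w
    & forall G : set (set F), proper_filter (@pf_adm F) G ->
        exists w : F, G = [set X | pf_adm X /\ X w]].

Definition closed_element (F : possFrame) (A : set F) : Prop :=
  exists2 Q : set (set F), Q `<=` @pf_adm F & RO_meet (@pf_le F) Q A.

Section Facts.
Variables (W : Type) (le : relation W).
Hypothesis le_order : Relation_Definitions.order W le.

Lemma RO_bigcap (Q : set (set W)) :
  Q `<=` RO le -> RO le (\bigcap_(X in Q) X).
Proof.
case: le_order => le_refl le_trans _ QRO.
apply/seteqP; split=> x; last first.
  move=> Qx y yx; exists y; first exact: le_refl.
  move=> X QX; have := Qx _ QX; rewrite -{1}(QRO _ QX) => Xx.
  rewrite -(QRO _ QX) => z zy; apply: Xx; exact: le_trans zy yx.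
move=> clx X QX; rewrite -(QRO _ QX) => y /clx[z zy Qz].
by exists z => //; exact: Qz.
Qed.

Lemma ro_least (X : set W) :
  [/\ RO le (ro le X), X `<=` ro le X
    & forall Y, RO le Y -> X `<=` Y -> ro le X `<=` Y].
Proof.
split.
- by apply: RO_bigcap => Y [].
- exact: sub_gen_smallest.
- by move=> Y ROY XY; apply: smallest_sub.
Qed.

Lemma RO_meetE (Q : set (set W)) (A : set W) :
  Q `<=` RO le -> RO_meet le Q A <-> A = \bigcap_(X in Q) X.
Proof.
move=> QRO; split=> [[_ lbA glbA]|->].
  apply/seteqP; split=> [x Ax X QX|]; first exact: (lbA _ QX).
  by apply: glbA; [exact: RO_bigcap | move=> X QX; exact: bigcap_inf].
split; first exact: RO_bigcap.
  by move=> X QX; exact: bigcap_inf.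
by move=> B _ lbB x Bx X QX; exact: (lbB _ QX).
Qed.

End Facts.

(* Main.v *)
(** Condition (ii) of filter-descriptiveness says that the admissible sets
    containing [w] intersect in the principal downset of [w]. That downset is
    therefore regular open, and since every regular open set is a downset, it
    is the least regular open set containing [w]. *)

From Corelib Require Import Relation_Definitions.
Require Import Defs.
From mathcomp Require Import all_boot.
From mathcomp Require Import boolp classical_sets.

Local Open Scope classical_set_scope.

Section PrincipalDownset.
Context {W : Type} (le : relation W).

Definition principal_downset (w : W) : set W := [set v | le v w].

Lemma principal_downset_sub_RO (X : set W) (w : W) :
  Relation_Definitions.transitive W le -> RO le X -> X w ->
  principal_downset w `<=` X.
Proof.
move=> le_trans ROX Xw v vw; rewrite -ROX in Xw *.
by move=> u uv; apply: Xw; exact: le_trans uv vw.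
Qed.

Lemma ro_set1 (w : W) :
  Relation_Definitions.order W le -> RO le (principal_downset w) ->
  ro le [set w] = principal_downset w.
Proof.
move=> le_order ROw; have [le_refl le_trans _] := le_order.
have [RO_ro sub_ro ro_min] := ro_least le_order [set w].
apply/seteqP; split.
- by apply: ro_min => // _ ->; exact: le_refl.
- by apply: principal_downset_sub_RO => //; exact: sub_ro.
Qed.

End PrincipalDownset.

Section TightFamily.
Context {W : Type} (le : relation W) (P : set (set W)).

Definition sets_containing (w : W) : set (set W) := [set X | P X /\ X w].

Definition le_tight : Prop :=
  forall w v : W, (forall X, P X -> X w -> X v) -> le v w.

Lemma sets_containing_sub (w : W) : sets_containing w `<=` P.
Proof. by move=> X []. Qed.

Lemma bigcap_sets_containing (w : W) :
  Relation_Definitions.transitive W le -> P `<=` RO le -> le_tight ->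
  \bigcap_(X in sets_containing w) X = principal_downset le w.
Proof.
move=> le_trans P_RO P_tight; apply/seteqP; split=> [v capv|].
- by apply: P_tight => X PX Xw; exact: capv.
- apply: sub_bigcap => X [/P_RO ROX Xw].
  exact: principal_downset_sub_RO.
Qed.

Lemma ro_set1_bigcap (w : W) :
  Relation_Definitions.order W le -> P `<=` RO le -> le_tight ->
  ro le [set w] = \bigcap_(X in sets_containing w) X.
Proof.
move=> le_order P_RO P_tight; have [_ le_trans _] := le_order.
have capE := bigcap_sets_containing w le_trans P_RO P_tight.
rewrite capE; apply: ro_set1 => //; rewrite -capE.
apply: RO_bigcap => //.
exact: subset_trans (@sets_containing_sub w) P_RO.
Qed.

End TightFamily.

Lemma closed_elementP (F : possFrame) (A : set F) :
  closed_element A <->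
  exists2 Q : set (set F), Q `<=` @pf_adm F & A = \bigcap_(X in Q) X.
Proof.
have [adm_RO _ _ _] := pf_subalg F.
have meetE Q : Q `<=` @pf_adm F ->
    RO_meet (@pf_le F) Q A <-> A = \bigcap_(X in Q) X.
  move=> Qadm; apply: RO_meetE; first exact: pf_order.
  exact: subset_trans Qadm adm_RO.
by split=> -[Q Qadm QA]; exists Q => //; apply/meetE.
Qed.

Theorem mainTheorem9 (F : possFrame) (F_descr : filter_descriptive F)
    (A : set F) (A_PsAt : PsAt (@pf_le F) A) :
  closed_element A /\
  (exists2 Q : set (set F), Q `<=` @pf_adm F & A = \bigcap_(X in Q) X).
Proof.
have [_ adm_tight _] := F_descr; have [adm_RO _ _ _] := pf_subalg F.
have A_bigcap : exists2 Q : set (set F),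
    Q `<=` @pf_adm F & A = \bigcap_(X in Q) X.
  case: A_PsAt => w _ <-; exists (sets_containing (@pf_adm F) w).
    exact: sets_containing_sub.
  exact: ro_set1_bigcap (pf_order F) adm_RO adm_tight.
by split=> //; apply/closed_elementP.
Qed.
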